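(* In ZFC, $\mathfrak{dp}=\mathfrak{adp}$.
   Context: $[\omega]^{\aleph_0}$ is the set of infinite subsets of $\omega$. For $a,b\subseteq\omega$, $a\perp b$ means that $a\cap b$ is finite. For $\mathcal A,\mathcal B\subseteq[\omega]^{\aleph_0}$, $\mathcal A\perp\mathcal B$ means $a\perp b$ for all $a\in\mathcal A$, $b\in\mathcal B$. $\mathcal A$ is weakly separated from $\mathcal B$ if there is $X\subseteq\omega$ such that $a\cap X$ is infinite for every $a\in\mathcal A$ and $b\cap X$ is finite for every $b\in\mathcal B$ (this notion is not symmetric). $\mathcal A\subseteq[\omega]^{\aleph_0}$ is an almost disjoint family if $a\perp b$ for every two distinct $a,b\in\mathcal A$. $\mathfrak{dp}$ is the least cardinal $\kappa$ for which there exist $\mathcal A,\mathcal B\subseteq[\omega]^{\aleph_0}$ such that $\mathcal A\perp\mathcal B$, $|\mathcal A\cup\mathcal B|=\kappa$, and $\mathcal A$ is not weakly separated from $\mathcal B$. $\mathfrak{adp}$ is the least cardinal $\kappa$ for which there exist $\mathcal A,\mathcal B\subseteq[\omega]^{\aleph_0}$ such that $\mathcal A\perp\mathcal B$, $|\mathcal A\cup\mathcal B|=\kappa$, $\mathcal A$ is an almost disjoint family, and $\mathcal A$ is not weakly separated from $\mathcal B$. *)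

(* Defs.v *)
From mathcomp Require Import all_boot all_classical.

Set Implicit Arguments.
Unset Strict Implicit.
Unset Printing Implicit Defensive.

Local Open Scope classical_set_scope.
Local Open Scope card_scope.

Definition infinite_subsets : set (set nat) := [set a | infinite_set a].

Definition orth (a b : set nat) : Prop := finite_set (a `&` b).

Definition orth_families (A B : set (set nat)) : Prop :=
  forall a b, A a -> B b -> orth a b.

Definition weakly_separated (A B : set (set nat)) : Prop :=
  exists X : set nat, (forall a, A a -> infinite_set (a `&` X)) /\
                      (forall b, B b -> finite_set (b `&` X)).

Definition almost_disjoint (A : set (set nat)) : Prop :=
  A `<=` infinite_subsets /\
  forall a b, A a -> A b -> a <> b -> orth a b.

Definition dp_pair (A B : set (set nat)) : Prop :=
  [/\ A `<=` infinite_subsets, B `<=` infinite_subsets,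
      orth_families A B & ~ weakly_separated A B].

Definition adp_pair (A B : set (set nat)) : Prop :=
  [/\ A `<=` infinite_subsets, B `<=` infinite_subsets,
      orth_families A B, almost_disjoint A & ~ weakly_separated A B].

(* The library has no type of cardinal numbers: a cardinal is given by a set
   of that cardinality, and cardinals are compared with [#=] and [#<=]. *)
Definition least_card (T : Type) (F : set (set T)) (K : set T) : Prop :=
  F K /\ forall L, F L -> K #<= L.

Definition unions_of (P : set (set nat) -> set (set nat) -> Prop) :
    set (set (set nat)) :=
  [set K | exists A B, P A B /\ K = A `|` B].

Lemma least_card_exists (T : pointedType) (F : set (set T)) :
  F !=set0 -> exists K, least_card F K.
Proof.
move=> [A0 FA0].
(* A maximal set of choice functions that are pairwise distinct at every
   member of F projects onto some member of F. *)
pose P (S : set (set T -> T)) :=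
  (forall s, S s -> forall A, F A -> A (s A)) /\
  (forall s t, S s -> S t -> forall A, F A -> s A = t A -> s = t).
have [|S [[Sin Sinj] Smax]] := @Zorn_bigcup _ P.
  move=> C CP tot; split.
    by move=> s [X CX Xs]; have [h _] := CP _ CX; exact: h.
  move=> s t [X CX Xs] [Y CY Yt].
  have [XY|YX] := tot _ _ CX CY.
  - by have [_ h] := CP _ CY; apply: h => //; exact: XY.
  - by have [_ h] := CP _ CX; apply: h => //; exact: YX.
have [K [FK Ksurj]] :
    exists K, F K /\ forall x, K x -> exists2 s, S s & s K = x.
  apply: contrapT => noK.
  have new A : exists x, F A -> A x /\ forall s, S s -> s A <> x.
    have [FA|nFA] := pselect (F A); last by exists point.
    apply: contrapT => nx; apply: noK; exists A; split=> // x Ax.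
    apply: contrapT => nos; apply: nx; exists x => _; split=> // s Ss sAx.
    by apply: nos; exists s.
  pose t A := sval (cid (new A)).
  have tP A : F A -> A (t A) /\ forall s, S s -> s A <> t A.
    by move=> FA; exact: (svalP (cid (new A)) FA).
  have nSt : ~ S t by move=> St; have [_ /(_ _ St)] := tP _ FA0; exact.
  apply: (Smax (S `|` [set t])).
    split.
      by move=> s Ss; left.
    by move=> E; apply: nSt; apply: E; right.
  split.
    by move=> s [Ss|->] A FA; [exact: (Sin _ Ss)|have [] := tP _ FA].
  move=> s u [Ss|->] [Su|->] A FA //; first exact: (Sinj _ _ Ss Su _ FA).
  - by have [_ /(_ _ Ss)] := tP _ FA.
  - by move=> E; have [_ /(_ _ Su)] := tP _ FA; rewrite E.
exists K; split=> // L FL.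
have pre x : exists s, K x -> S s /\ s K = x.
  have [Kx|nKx] := pselect (K x); last by exists (fun=> point).
  by have [s Ss sKx] := Ksurj _ Kx; exists s.
pose g x := sval (cid (pre x)).
have gP x : K x -> S (g x) /\ g x K = x by exact: (svalP (cid (pre x))).
have ginj : {in K &, injective (fun x => g x L)}.
  move=> x y /set_mem Kx /set_mem Ky E.
  have [Sx <-] := gP _ Kx; have [Sy <-] := gP _ Ky.
  by rewrite (Sinj _ _ Sx Sy _ FL E).
rewrite -(card_le_eql (inj_card_eq ginj)).
apply: subset_card_le => _ [x Kx <-].
by have [Sx _] := gP _ Kx; exact: (Sin _ Sx).
Qed.

Lemma infinite_range (f : nat -> nat) : injective f -> infinite_set (range f).
Proof.
move=> finj; have E : range f #= [set: nat] := inj_card_eq (in2W finj).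
by apply/infiniteP; rewrite (card_le_eqr E).
Qed.

Lemma adp_pair_exists : exists A B, adp_pair A B.
Proof.
pose C (n : nat) : set nat := range (fun m : nat => (pickle (n, m) : nat)).
have Cinf n : infinite_set (C n).
  by apply: infinite_range => x y /(pcan_inj pickleK) [].
have Cdisj n m k : C n k -> C m k -> n = m.
  by move=> [x _ <-] [y _] /(pcan_inj pickleK) [].
exists (range C), [set b | infinite_set b /\ forall n, orth (C n) b].
split.
- by move=> _ [n _ <-]; exact: Cinf.
- by move=> b [].
- by move=> _ b [n _ <-] [_]; exact.
- split; first by move=> _ [n _ <-]; exact: Cinf.
  move=> _ _ [n _ <-] [m _ <-] nm; rewrite /orth (_ : _ `&` _ = set0) //.
  by rewrite -subset0 => k [Cn Cm]; apply: nm; rewrite (Cdisj _ _ _ Cn Cm).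
move=> [X [XA XB]].
have pick n : exists k, (C n `&` X) k.
  by have /infinite_setN0 [k] := XA _ (ex_intro2 _ _ n I erefl); exists k.
pose f n := sval (cid (pick n)).
have fP n : (C n `&` X) (f n) := svalP (cid (pick n)).
have finj : injective f.
  move=> n m E; apply: (@Cdisj _ _ (f n)); first by have [] := fP n.
  by rewrite E; have [] := fP m.
have finf : infinite_set (range f) by exact: infinite_range.
have : finite_set (range f `&` X).
  apply: XB; split=> // n.
  apply: (@sub_finite_set _ _ [set f n]) => // k [Cnk [m _ E]].
  rewrite -E in Cnk *.
  by have [Cm _] := fP m; rewrite (Cdisj _ _ _ Cnk Cm).
rewrite (_ : _ `&` X = range f) //.
by apply/setIidl => _ [n _ <-]; have [] := fP n.
Qed.

Lemma dp_exists : exists K, least_card (unions_of dp_pair) K.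
Proof.
apply: least_card_exists; have [A [B [? ? ? _ ?]]] := adp_pair_exists.
by exists (A `|` B), A, B.
Qed.

Lemma adp_exists : exists K, least_card (unions_of adp_pair) K.
Proof.
apply: least_card_exists; have [A [B AB]] := adp_pair_exists.
by exists (A `|` B), A, B.
Qed.

Definition dp : set (set nat) := sval (cid dp_exists).
Definition adp : set (set nat) := sval (cid adp_exists).

Lemma dpP : least_card (unions_of dp_pair) dp.
Proof. exact: svalP (cid dp_exists). Qed.

Lemma adpP : least_card (unions_of adp_pair) adp.
Proof. exact: svalP (cid adp_exists). Qed.

(* Main.v *)
Require Import Defs.
From mathcomp Require Import all_boot all_classical.

(** One inequality holds because an adp-pair is a dp-pair.  For the other, a
    dp-pair [(A, B)] is moved from [nat] to the countable binary tree of finite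
    words.  Each [a] in [A] becomes a part of its own branch, namely the
    restrictions of its characteristic function to the lengths [k] in [a]
    ([lift a]); distinct branches share only finitely many nodes, so the new
    first family is almost disjoint whatever [A] was.  Each [b] in [B] becomes
    the union of the whole levels [k] of the tree with [k] in [b]
    ([level @^-1` b]).

    The level function is injective on every branch, carries [lift a] onto [a],
    and pulls [b] back to its new version.  Hence the intersection of the new
    versions of [a] and [b] is a copy of that of [a] and [b], which gives
    orthogonality, and if [X] weakly separated the new families then the set of
    levels that [X] meets would weakly separate [A] from [B]
    ([weakly_separated_level]).  The new pair is therefore an adp-pair, and it is
    indexed by [A `|` B], so it has at most that cardinality. *)

Set Implicit Arguments.
Unset Strict Implicit.
Unset Printing Implicit Defensive.

Local Open Scope classical_set_scope.
Local Open Scope card_scope.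

Definition node (a : set nat) (k : nat) : nat :=
  pickle (mkseq (fun i => i \in a) k).

(** Numbers that code no word are put at level 0; this is harmless since levels
    are only used through the identity [nodeK]. *)
Definition level (n : nat) : nat :=
  size (odflt [::] (unpickle n : option (seq bool))).

Definition lift (a : set nat) : set nat := node a @` a.

Lemma nodeK a : cancel (node a) level.
Proof. by move=> k; rewrite /level /node pickleK size_mkseq. Qed.

Lemma node_eq_agree a b k l i :
  node a k = node b l -> i < k -> (i \in a) = (i \in b).
Proof.
move=> E ik; have kl : k = l by rewrite -(nodeK a k) E nodeK.
move: E; rewrite -kl => /(pcan_inj pickleK) /(congr1 (nth false ^~ i)).
by rewrite !nth_mkseq.
Qed.

Lemma infinite_lift a : infinite_set a -> infinite_set (lift a).
Proof.
move=> ainf lfin; apply: ainf; apply: sub_finite_set (finite_image level lfin).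
by move=> k ak; exists (node a k); [exists k|exact: nodeK].
Qed.

Lemma infinite_level_preimage b :
  infinite_set b -> infinite_set (level @^-1` b).
Proof.
move=> /infinite_lift linf /(sub_finite_set _) sfin; apply: linf; apply: sfin.
by move=> _ [k bk <-]; rewrite /preimage /= nodeK.
Qed.

Lemma orth_lift_level a b : orth a b -> orth (lift a) (level @^-1` b).
Proof.
move=> /(finite_image (node a)); apply: sub_finite_set.
by move=> _ [[k ak <-]]; rewrite /preimage /= nodeK => bk; exists k.
Qed.

(** Two branches meet only below the first place where they split. *)
Lemma orth_lift a b : a <> b -> orth (lift a) (lift b).
Proof.
move=> ab; have [i abi] : exists i, (i \in a) <> (i \in b).
  apply: contrapT => same; apply: ab; apply/seteqP.
  have {}same i : (i \in a) = (i \in b).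
    by apply: contrapT => abi; apply: same; exists i.
  by split=> i /mem_set; [rewrite same|rewrite -same] => /set_mem.
apply: sub_finite_set (finite_image (node a) (finite_II i.+1)).
move=> _ [[k _ <-] [l _ /esym E]]; exists k => //=.
by rewrite ltnS leqNgt; apply/negP => ik; apply: abi; exact: node_eq_agree E ik.
Qed.

(** A separator of the new families projects to the set of levels it meets:
    projecting keeps it finite on each [b], and on a branch no two nodes are
    identified, so it keeps it infinite on each [a]. *)
Lemma weakly_separated_level (A B : set (set nat)) :
  weakly_separated (lift @` A) [set level @^-1` b | b in B] ->
  weakly_separated A B.
Proof.
move=> [X [XA XB]]; exists (level @` X); split.
  move=> a Aa afin; apply: (XA (lift a)); first by exists a.
  apply: sub_finite_set (finite_image (node a) afin).
  move=> _ [[k ak <-] Xk]; exists k => //; split=> //.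
  by exists (node a k); last exact: nodeK.
move=> b Bb; have bfin := XB _ (ex_intro2 _ _ b Bb erefl).
apply: sub_finite_set (finite_image level bfin).
by move=> k [bk [n Xn nk]]; exists n; first split; rewrite /preimage /= ?nk.
Qed.

Lemma dp_pair_adp_pair (A B : set (set nat)) :
  dp_pair A B -> adp_pair (lift @` A) [set level @^-1` b | b in B].
Proof.
move=> [Ainf Binf AB nsep].
have liftA_inf : lift @` A `<=` infinite_subsets.
  by move=> _ [a /Ainf ainf <-]; exact: infinite_lift.
split=> //.
- by move=> _ [b /Binf binf <-]; exact: infinite_level_preimage.
- by move=> _ _ [a Aa <-] [b Bb <-]; apply: orth_lift_level; exact: AB.
- split=> // _ _ [a _ <-] [b _ <-] ne.
  by apply: orth_lift => ab; apply: ne; rewrite ab.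
- by move=> /weakly_separated_level.
Qed.

(** As infinite sets, the members of [A] are not orthogonal to themselves, so
    [A] and [B] are disjoint and a single map defined by cases has the union of
    the two images as its image. *)
Lemma card_lift_pair (A B : set (set nat)) : dp_pair A B ->
  lift @` A `|` [set level @^-1` b | b in B] #<= A `|` B.
Proof.
move=> [Ainf _ AB _].
pose f a := if a \in A then lift a else level @^-1` a.
apply: card_le_trans (card_image_le f (A `|` B)); apply: subset_card_le.
move=> _ [[a Aa <-]|[b Bb <-]].
  by exists a; [left|rewrite /f mem_set].
exists b; first by right.
rewrite /f; case: ifPn => // /set_mem Ab.
by case: (Ainf _ Ab); have := AB _ _ Ab Bb; rewrite /orth setIid.
Qed.

Theorem theorem6 : dp #= adp.
Proof.
have [[A [B [AB dpE]]] dp_min] := dpP.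
have [[C [D [[Cinf Dinf CD _ nsep] adpE]]] adp_min] := adpP.
rewrite card_eq_le; apply/andP; split.
  by apply: dp_min; exists C, D.
rewrite [in X in _ #<= X]dpE; apply: card_le_trans (card_lift_pair AB).
by apply: adp_min; do 2!eexists; split; first exact: dp_pair_adp_pair AB.
Qed.
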